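(* Let $D=(V,E)$ be a finite digraph without loops, $H=(U,F)$ a digraph (loops allowed), $\varsigma\colon E\to U$ an $H$-colouring of $D$, and $E=E_1\sqcup E_2$ a partition of the arcs, $D_1=(V,E_1)$. Let $\mathcal{S}=\mathcal{S}(D)$ be the $H$-semikernel digraph of $D$ modulo $E_1$. If every directed cycle of $D$ contained in $E_1$ is an $H$-cycle, then $\mathcal{S}$ is acyclic.
   Context: An $H$-colouring is a function $\varsigma\colon E\to U$. A walk $z_0\dots z_k$ ($k\ge1$) in $D$ is an $H$-walk if for each $1\le i\le k-1$, $\varsigma(z_{i-1}z_i)\varsigma(z_iz_{i+1})\in F$. A directed cycle is an $H$-cycle if the colours of its arcs, read cyclically, form a closed walk in $H$. A set $S\subseteq V$ is $H$-independent if there is no $H$-walk between two distinct elements of $S$. $S\subseteq V$ is an $H$-semikernel modulo $E_1$ if $S$ is $H$-independent and for every $z\in V\setminus S$, whenever there is an $H$-walk with all arcs in $E_2$ from a vertex of $S$ to $z$, there is an $H$-walk in $D$ from $z$ to a vertex of $S$. The $H$-semikernel digraph $\mathcal{S}(D)$ modulo $E_1$ has as vertices the nonempty $H$-semikernels modulo $E_1$, and an arc from $S_1$ to $S_2$ ($S_1\ne S_2$) iff for every $s_1\in S_1\setminus S_2$ there exists $s_2\in S_2\setminus S_1$ such that there is an $H$-walk from $s_1$ to $s_2$ with all arcs in $E_1$ and there is no $H$-walk in $D$ from $s_2$ to any vertex of $S_1$. *)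

(* Defs.v *)
From mathcomp Require Import all_boot.
Set Implicit Arguments.
Unset Strict Implicit.
Unset Printing Implicit Defensive.

(* A directed cycle is the list of its (pairwise distinct) vertices in cyclic
   order; a one-element list is a loop and a two-element list is a digon. *)
Definition dicycle (T : eqType) (R : T -> T -> Prop) (c : seq T) : Prop :=
  [/\ c <> [::], uniq c & forall x, x \in c -> R x (next c x)].

Definition acyclic (T : eqType) (R : T -> T -> Prop) : Prop :=
  ~ exists c : seq T, dicycle R c.

Section HColouring.

(* The digraph D is (V, E) with E a set of ordered pairs, and H is (U, F).
   The colouring is defined on the arcs of D only. *)
Variables (V : finType) (E : {set V * V}).
Variables (U : Type) (F : U -> U -> Prop).
Variable col : {e : V * V | e \in E} -> U.

Definition Hturn (u v w : V) : Prop :=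
  exists e f : {e : V * V | e \in E},
    [/\ val e = (u, v), val f = (v, w) & F (col e) (col f)].

(* The walk z_0 ... z_k is the list z_0 :: p, with k = size p. *)
Definition Hwalk (A : {set V * V}) (z0 : V) (p : seq V) : Prop :=
  let z := nth z0 (z0 :: p) in
  [/\ 1 <= size p,
      forall i, i < size p -> (z i, z i.+1) \in A
    & forall i, 1 <= i <= (size p).-1 -> Hturn (z i.-1) (z i) (z i.+1)].

Definition Hreach (A : {set V * V}) (x y : V) : Prop :=
  exists p : seq V, Hwalk A x p /\ last x p = y.

Definition Hcycle (c : seq V) : Prop :=
  dicycle (fun x y => (x, y) \in E) c /\
  forall v, v \in c -> Hturn (prev c v) v (next c v).

Definition Hindependent (S : {set V}) : Prop :=
  forall x y, x \in S -> y \in S -> x <> y -> ~ Hreach E x y.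

Definition Hsemikernel (E2 : {set V * V}) (S : {set V}) : Prop :=
  Hindependent S /\
  forall z, z \notin S ->
    (exists2 s, s \in S & Hreach E2 s z) ->
    exists2 s, s \in S & Hreach E z s.

Definition Hsemikernel_vertex (E2 : {set V * V}) (S : {set V}) : Prop :=
  S <> set0 /\ Hsemikernel E2 S.

Definition Hsemikernel_arc (E1 E2 : {set V * V}) (S1 S2 : {set V}) : Prop :=
  [/\ Hsemikernel_vertex E2 S1, Hsemikernel_vertex E2 S2, S1 <> S2
    & forall s1, s1 \in S1 :\: S2 ->
        exists s2, [/\ s2 \in S2 :\: S1, Hreach E1 s1 s2
                     & forall s, s \in S1 -> ~ Hreach E s2 s]].

End HColouring.

(* Main.v *)
Require Import Defs.
From mathcomp Require Import all_boot zify.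
From Stdlib Require Import Classical Relations.
Set Implicit Arguments.
Unset Strict Implicit.
Unset Printing Implicit Defensive.

(** Write [x R y] for H-reachability inside [E1]. A cycle of semikernels yields
    a cyclic sequence of vertices, each reaching the next one but not reached
    back by it, so it suffices to refute such a sequence [s].

    For a vertex [q] let [x <=_q y] mean that some walk in [E1] from [x] to [y]
    has H-turns at its visits to [q] (turns elsewhere being free); this composes
    at vertices other than [q], and [x R y] implies [x <=_q y].

    Apex: if [a R b], not [b R a], and some walk in [E1] leads from [b] to [a],
    then there is [q] with not [b <=_q a], and [q] lies on the walk from [a]
    to [b], so [a R q R b]. Otherwise a walk from [b] to [a] could be repaired
    at one vertex [q] after the other: arriving at [q], run round a cycle
    through [b], follow a walk witnessing [b <=_q a], whose excursions from [q]
    may be taken to be cycles, and return round a cycle through [a]. Cycles in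
    [E1] are H-cycles, so no bad turn is created.

    Descent: if [q] is the apex of the step from [s k] to [s k.+1], the sequence
    must visit [q] before it comes back to [s k]. The apex of the step entering
    [q] at the first such visit [s j] must itself be visited between [s k.+1]
    and [s j.-1], and symmetrically for the step leaving an apex. The index
    intervals shrink forever, a contradiction. *)

(** * Walks as chains of arcs, with turns constrained at chosen vertices *)

Section Walks.
Variables (V : finType) (A : {set V * V}) (turn : V -> V -> V -> Prop).

Definition step (Q : seq V) (e f : V * V) : Prop :=
  [/\ e \in A, f \in A, e.2 = f.1 & (e.2 \in Q -> turn e.1 e.2 f.2)].

Notation steps Q := (clos_refl_trans _ (step Q)).

(* Walks are represented by their first and last arcs, hence have length >= 1;
   only turns at vertices of [Q] are constrained. *)
Definition reach (Q : seq V) (x y : V) : Prop :=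
  exists u v, [/\ (x, u) \in A, (v, y) \in A & steps Q (x, u) (v, y)].

Definition avoiding (q : V) : rel V :=
  connect [rel x y | [&& (x, y) \in A, x != q & y != q]].

Lemma avoiding_arc q x y : (x, y) \in A -> x != q -> y != q -> avoiding q x y.
Proof. by move=> xy xq yq; apply: connect1; rewrite /= xy xq. Qed.

Lemma steps_sub Q Q' e f :
  {subset Q' <= Q} -> steps Q e f -> steps Q' e f.
Proof.
move=> sQ; elim => {e f} [e f [eA fA ef tQ]|e|e g f _ IH1 _ IH2].
- by apply: rt_step; split => // /sQ; apply: tQ.
- exact: rt_refl.
- exact: rt_trans IH1 IH2.
Qed.

Lemma reach_sub Q Q' x y : {subset Q' <= Q} -> reach Q x y -> reach Q' x y.
Proof.
by move=> sQ [u [v [xu vy uv]]]; exists u, v; split => //; apply: steps_sub uv.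
Qed.

Lemma reach_trans Q x y z :
  y \notin Q -> reach Q x y -> reach Q y z -> reach Q x z.
Proof.
move=> yQ [u [v [xu vy uv]]] [u' [v' [yu' v'z uv']]].
exists u, v'; split => //; apply: rt_trans uv (rt_trans _ _ _ _ _ _ uv').
by apply: rt_step; split => //= yQ'; rewrite yQ' in yQ.
Qed.

(** The walk is cut at its first arrival at [q]. Up to there no turn is made at [q], so the list of
    constrained vertices grows to [q :: Q] for free. *)
Lemma steps_first Q q e f :
    e \in A -> e.1 != q -> steps Q e f ->
  [/\ f.2 != q, avoiding q e.1 f.2 & steps (q :: Q) e f] \/
  exists t, [/\ (t, q) \in A, avoiding q e.1 t, steps (q :: Q) e (t, q)
              & steps Q (t, q) f].
Proof.
move=> eA eq ef; have {}ef := clos_rt_rt1n _ _ _ _ ef; elim: ef eA eq => {e f} [[u v]|[u v] [v' w] f].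
  move=> eA /= uq; case: (eqVneq v q) => [vq|vq].
    by right; exists u; rewrite -vq; split => //; [exact: connect0|exact: rt_refl..].
  by left; split => //; [exact: avoiding_arc|exact: rt_refl].
move=> [/= uv vw vv' tQ]; subst v' => vwf IH _ uq; have {}vwf := clos_rt1n_rt _ _ _ _ vwf.
case: (eqVneq v q) => [vq|vq].
  right; exists u; rewrite -vq; split => //; [exact: connect0|exact: rt_refl|].
  by apply: rt_trans vwf; apply: rt_step.
have st : step (q :: Q) (u, v) (v, w).
  by split => //=; rewrite inE (negPf vq).
have uvq := avoiding_arc uv uq vq.
case: (IH vw vq) => [[fq vf vwf']|[t [tq vt vwt tf]]].
  left; split => //; first exact: connect_trans uvq vf.
  exact: rt_trans (rt_step _ _ _ _ st) vwf'.
right; exists t; split => //; first exact: connect_trans uvq vt.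
exact: rt_trans (rt_step _ _ _ _ st) vwt.
Qed.

Lemma steps_last Q q e f :
    e \in A -> f.2 != q -> steps Q e f ->
  [/\ e.1 != q, e.2 != q, avoiding q e.1 f.2 & steps (q :: Q) e f] \/
  exists w, [/\ (q, w) \in A, avoiding q w f.2, steps Q e (q, w)
              & steps (q :: Q) (q, w) f].
Proof.
move=> eA fq ef; have {}ef := clos_rt_rt1n _ _ _ _ ef; elim: ef eA fq => {e f} [[u v]|[u v] [v' w] f].
  move=> uv /= vq; case: (eqVneq u q) => [uq|uq].
    by right; exists v; rewrite -uq; split => //; [exact: connect0|exact: rt_refl..].
  by left; split => //; [exact: avoiding_arc|exact: rt_refl].
move=> [/= uv vw vv' tQ]; subst v' => vwf IH _ fq; have {}vwf := clos_rt1n_rt _ _ _ _ vwf.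
have st : step Q (u, v) (v, w) by [].
case: (IH vw fq) => [[vq wq vf vwf']|[t [tq vt vwt tf]]]; last first.
  by right; exists t; split => //; apply: rt_trans (rt_step _ _ _ _ st) vwt.
have st' : step (q :: Q) (u, v) (v, w).
  by split => //=; rewrite inE (negPf vq).
have uvf := rt_trans _ _ _ _ _ (rt_step _ _ _ _ st') vwf'.
case: (eqVneq u q) => [uq|uq].
  by subst u; right; exists v; split => //; apply: rt_refl.
left; split => //; exact: connect_trans (avoiding_arc uv uq vq) vf.
Qed.

(** Cutting at the first arrival [(t, q)] and the last departure [(q, w)] confines all turns at [q]
    to the middle piece, the only one left to repair. *)
Lemma reach_split Q q x y :
    x != q -> y != q -> reach Q x y ->
  avoiding q x y /\ reach (q :: Q) x y \/
  exists u v t w,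
    [/\ (x, u) \in A, (v, y) \in A, (t, q) \in A & (q, w) \in A] /\
    [/\ avoiding q x t, avoiding q w y, steps (q :: Q) (x, u) (t, q),
        steps Q (t, q) (q, w) & steps (q :: Q) (q, w) (v, y)].
Proof.
move=> xq yq [u [v [xu vy uv]]].
case: (@steps_first Q q (x, u) _ xu xq uv) => [[_ xy uv']|[t [tq xt ut tv]]].
  by left; split => //; exists u, v.
case: (@steps_last Q q _ (v, y) tq yq tv) => [[_]|[w [qw wy tw wv]]]; first by rewrite eqxx.
by right; exists u, v, t, w.
Qed.

(** * Repairing turns by means of cycles *)

Hypothesis loopless : forall v, (v, v) \notin A.
Hypothesis turn_cycle : forall c : seq V,
  uniq c -> cycle [rel x y | (x, y) \in A] c ->
  forall v, v \in c -> turn (prev c v) v (next c v).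

Lemma arc_neq u v : (u, v) \in A -> u != v.
Proof. by apply: contraTneq => ->; apply: loopless. Qed.

Lemma prev_head (x : V) p : uniq (x :: p) -> prev (x :: p) x = last x p.
Proof.
rewrite /= => /andP[xp _].
suff H y : prev_at x x y p = last y p by apply: H.
elim: p y xp => [|z p IHp] y /=; first by rewrite eqxx.
by rewrite inE negb_or => /andP[/negPf-> /IHp].
Qed.

(** A simple path from [w] to [t] off [q] closes up through [q] to a directed cycle, all of whose
    turns are good. *)
Lemma avoiding_cycle q t w :
    (t, q) \in A -> (q, w) \in A -> avoiding q w t ->
  turn t q w /\ forall Q, steps Q (q, w) (t, q).
Proof.
move=> tq qw /connectP[p0 p0_path def_t].
case: (shortenP p0_path) def_t => p p_path p_uniq _ def_t {p0 p0_path}.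
have wq : w != q by rewrite eq_sym arc_neq.
have [pA pq] : path [rel x y | (x, y) \in A] w p /\ q \notin w :: p.
  rewrite inE eq_sym (negPf wq) /=; clear - p_path.
  elim: p w p_path => //= x p IHp w /andP[/and3P[-> _ xq] /IHp[-> pq]].
  by rewrite inE eq_sym (negPf xq).
pose c := q :: w :: p.
have c_uniq : uniq c by rewrite /c cons_uniq pq.
have c_cycle : cycle [rel x y | (x, y) \in A] c.
  by rewrite /c /= qw rcons_path pA -def_t.
have prev_q : prev c q = t by rewrite /c prev_head // def_t.
have next_q : next c q = w by rewrite /c /= eqxx.
split; first by rewrite -prev_q -next_q; apply: turn_cycle; rewrite ?mem_head.
move=> Q; have tc : t \in c by rewrite -prev_q mem_prev mem_head.
have next_t : next c t = q by rewrite -prev_q next_prev.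
(* Both arcs have the form [(x, next c x)], with [x] equal to [q] and to [t]; the induction is on
   the number of steps along the cycle from [q] to [t]. *)
have /iter_findex : fconnect (next c) q t.
  by rewrite (fconnect_cycle (cycle_next c_uniq)) // mem_head.
move: (findex _ _ _) => n def_n.
rewrite -next_q -{3}next_t -def_n.
have : iter n (next c) q \in c by rewrite def_n.
rewrite {def_n}; elim: n => [|n IHn]; first by move=> _; apply: rt_refl.
rewrite iterS mem_next => xc; apply: rt_trans (IHn xc) (rt_step _ _ _ _ _).
move: xc; set x := iter n _ q => xc.
have nxc : next c x \in c by rewrite mem_next.
split; [exact: (next_cycle c_cycle xc)|exact: (next_cycle c_cycle nxc)|by []|].
by move=> _; rewrite -{1}(prev_next c_uniq x); apply: turn_cycle.
Qed.

Lemma steps_cycle Q q t w :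
  (t, q) \in A -> (q, w) \in A -> avoiding q w t -> steps Q (q, w) (t, q).
Proof. by move=> tq qw wt; case: (avoiding_cycle tq qw wt). Qed.

Lemma steps_turn Q q t w :
  (t, q) \in A -> (q, w) \in A -> avoiding q w t -> steps Q (t, q) (q, w).
Proof.
by move=> tq qw wt; apply: rt_step; split => // _; case: (avoiding_cycle tq qw wt).
Qed.

(* The excursions of the walk between its visits to q can be replaced by cycles
   through q with the same end arcs. *)
Lemma steps_return Q q t w :
  (t, q) \in A -> steps [:: q] (t, q) (q, w) -> steps Q (t, q) (q, w).
Proof.
move=> tq tw.
(* The second clause treats an arc [e] inside an excursion begun by [(q, w0)]: of its past only
   [avoiding q w0 e.1] is kept, enough to close a cycle when the walk returns to [q]. *)
suff exc e : e \in A -> steps [:: q] e (q, w) ->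
    (e.1 = q -> steps Q e (q, w)) /\
    (forall w0, (q, w0) \in A -> e.1 != q -> avoiding q w0 e.1 ->
       steps Q (q, w0) (q, w)).
  have {}tw := clos_rt_rt1n _ _ _ _ tw; inversion tw as [tqw|[x z] ? st xw].
    by move: (arc_neq tq); subst; rewrite eqxx.
  case: st => /= _ xz qx tn; subst x; have {}xw := clos_rt1n_rt _ _ _ _ xw.
  apply: rt_trans (proj1 (exc _ xz xw) erefl).
  by apply: rt_step; split => //= _; apply: tn; rewrite inE.
move=> eA; move def_f : (q, w) => f ef; have {}ef := clos_rt_rt1n _ _ _ _ ef.
elim: ef eA def_f => {e f} [e _ <-|[u v] [v' z] f [/= uv vz vv' tn] _ IH _ def_f].
  by split => [_|w0 _]; [exact: rt_refl|rewrite eqxx].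
subst v'; case: (IH vz def_f) => IH1 IH2; split => [uq|w0 qw0 uq w0u].
  subst u; apply: (IH2 v uv _ (connect0 _ _)).
  by rewrite eq_sym arc_neq.
case: (eqVneq v q) => [vq|vq]; last first.
  exact: IH2 qw0 vq (connect_trans w0u (avoiding_arc uv uq vq)).
subst v; apply: rt_trans (steps_cycle Q uv qw0 w0u) (rt_trans _ _ _ _ _ _ (IH1 erefl)).
by apply: rt_step; split => //= _; apply: tn; rewrite inE.
Qed.

Notation full := (enum V).

(* Through q, go back to b, follow the walk from b to a that turns properly at
   q, and go on from a to q. *)
Lemma steps_splice q a b t w :
    a != q -> b != q -> reach full a b -> reach [:: q] b a ->
    (t, q) \in A -> (q, w) \in A -> avoiding q b t -> avoiding q w a ->
  steps full (t, q) (q, w).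
Proof.
move=> aq bq ab ba tq qw bt wa.
case: (reach_split aq bq ab) => [[avab _]|].
  by apply: steps_turn => //; apply: connect_trans wa (connect_trans avab bt).
move=> [_ [_ [t2 [w1 [[_ _ t2q qw1] [at2 w1b _ _ _]]]]]].
(* On the walk from [a] to [b], [t2] precedes the first visit to [q] and [w1] follows the last. The
   turn [t q w1] lies on a cycle because [w1] reaches [t] via [b], and [t2 q w] because [w] reaches
   [t2] via [a]. It remains to get from [(q, w1)] to [(t2, q)]. *)
apply: rt_trans (steps_turn _ tq qw1 (connect_trans w1b bt)) _.
have t2w := steps_turn full t2q qw (connect_trans wa at2).
apply: rt_trans t2w.
case: (reach_split bq aq ba) => [[avba _]|].
  exact: steps_cycle (connect_trans w1b (connect_trans avba at2)).
move=> [_ [_ [t' [w' [[_ _ t'q qw'] [bt' w'a _ tw' _]]]]]].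
apply: rt_trans (steps_cycle _ t'q qw1 (connect_trans w1b bt')) _.
apply: rt_trans (steps_cycle _ t2q qw' (connect_trans w'a at2)).
exact: steps_return (steps_sub _ tw').
Qed.

Lemma reach_back a b :
    a != b -> reach full a b -> reach [::] b a ->
    (forall q, q != a -> q != b -> reach [:: q] b a) ->
  reach full b a.
Proof.
move=> ab Rab Pba Rq; elim: full => // q Q IHQ.
(* At an end of the walk trimming suffices: start at the last departure from [b], stop at the first
   arrival at [a]. *)
case: (eqVneq q b) => [->|qb].
  case: IHQ => u [v [bu va uv]].
  case: (@steps_last Q b _ (v, a) bu ab uv) => [[]|[w [bw _ _ wv]]]; first by rewrite eqxx.
  by exists w, v.
case: (eqVneq q a) => [->|qa].
  case: IHQ => u [v [bu va uv]].
  rewrite eq_sym in ab.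
  case: (@steps_first Q a (b, u) _ bu ab uv) => [[]|[t [ta _ ut _]]]; first by rewrite eqxx.
  by exists u, t.
move: (qa) (qb); rewrite eq_sym => aq; rewrite eq_sym => bq.
case: (reach_split bq aq IHQ) => [[]//|].
move=> [u [v [t [w [[bu va tq qw] [bt wa ut _ wv]]]]]].
(* The spliced middle piece has good turns everywhere, so vertices repaired earlier stay
   repaired. *)
exists u, v; split => //; apply: rt_trans ut (rt_trans _ _ _ _ _ _ wv).
apply: steps_sub (steps_splice aq bq Rab (Rq q qa qb) tq qw bt wa).
by move=> x _; rewrite mem_enum.
Qed.

Lemma reach_apex a b :
    reach full a b -> ~ reach full b a -> reach [::] b a ->
  exists q, [/\ q != a, q != b, ~ reach [:: q] b a, reach full a q
              & reach full q b].
Proof.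
move=> Rab nRba Pba.
have ab : a != b by apply/eqP => ab; subst b.
apply: NNPP => no_q; apply: nRba; apply: reach_back => // q qa qb.
apply: NNPP => nRq; apply: no_q; exists q.
move: (qa) (qb); rewrite eq_sym => aq; rewrite eq_sym => bq.
(* If the walk from [a] to [b] missed [q], it would put the turn from first arrival to last
   departure of a walk from [b] to [a] on a cycle, contradicting [nRq]. *)
case: (reach_split aq bq Rab) => [[avab _]|].
  case: nRq; case: (reach_split bq aq Pba) => [[]//|].
  move=> [u [v [t [w [[bu va tq qw] [bt wa ut _ wv]]]]]].
  exists u, v; split => //; apply: rt_trans ut (rt_trans _ _ _ _ _ _ wv).
  by apply: steps_turn => //; apply: connect_trans wa (connect_trans avab bt).
move=> [u [v [t [w [[au vb tq qw] [_ _ ut _ wv]]]]]].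
have sub x : x \in full -> x \in q :: full by rewrite inE orbC => ->.
split => //; [exists u, t|exists w, v]; split => //; exact: steps_sub sub _.
Qed.

End Walks.

(** * Infinite descent along a periodic sequence *)

Section Descent.
Variables (T : eqType) (R : T -> T -> Prop) (le : T -> T -> T -> Prop).
Variables (s : nat -> T) (m : nat).
Hypothesis s_periodic : forall k, s (k + m) = s k.
Hypothesis le_refl : forall q x, le q x x.
Hypothesis le_trans : forall q x y z,
  y != q -> le q x y -> le q y z -> le q x z.
Hypothesis R_le : forall q x y, R x y -> le q x y.
Hypothesis s_step : forall k, R (s k) (s k.+1).
Hypothesis s_apex : forall k, exists q,
  [/\ q != s k, q != s k.+1, ~ le q (s k.+1) (s k), R (s k) q & R q (s k.+1)].

Lemma le_segment q i j :
  i <= j -> (forall l, i <= l <= j -> s l != q) -> le q (s i) (s j).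
Proof.
elim: j => [|j IHj] ij nq; first by have -> : i = 0 by lia.
case: (eqVneq i j.+1) => [->|ij']; first exact: le_refl.
have {ij ij'}ij : i <= j by lia.
apply: (@le_trans _ _ (s j)); [by apply: nq; lia| |exact: R_le].
by apply: IHj => // l lij; apply: nq; lia.
Qed.

Lemma visit q i j : i <= j -> ~ le q (s i) (s j) ->
  exists l, (i <= l <= j) && (s l == q).
Proof.
move=> ij nle; apply: NNPP => nv; apply: nle; apply: le_segment => // l ilj.
by apply/negP => sl; apply: nv; exists l; rewrite ilj.
Qed.

Lemma last_visit q i j : i <= j -> ~ le q (s i) (s j) ->
  exists l, [/\ i <= l <= j, s l = q & forall l', l < l' <= j -> s l' != q].
Proof.
move=> ij nle; have bound l : (i <= l <= j) && (s l == q) -> l <= j by lia.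
case: (ex_maxnP (visit ij nle) bound) => l /andP[ilj /eqP sl] max_l.
exists l; split => // l' ll'; apply/negP => sl'.
by have := max_l l'; rewrite sl' andbT; lia.
Qed.

Lemma first_visit q i j : i <= j -> ~ le q (s i) (s j) ->
  exists l, [/\ i <= l <= j, s l = q & forall l', i <= l' < l -> s l' != q].
Proof.
move=> ij nle; case: (ex_minnP (visit ij nle)) => l /andP[ilj /eqP sl] min_l.
exists l; split => // l' l'l; apply/negP => sl'.
by have := min_l l'; rewrite sl' andbT; lia.
Qed.

(** [j] is the first index after [k] that visits a vertex [q] obstructing the way back from [s k.+1]
    to [s k]; [backward_gap] is the mirror image. *)
Definition forward_gap k j := exists q,
  [/\ q != s k.+1, ~ le q (s k.+1) (s k), k.+1 <= j, s j = q
    & forall l, k < l < j -> s l != q].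

Definition backward_gap i l := exists r,
  [/\ r != s l, ~ le r (s l.+1) (s l), i <= l, s i = r
    & forall l', i < l' <= l -> s l' != r].

(** Let [r] be the apex of the step entering [q], last visited at [i]. If [i <= k], one could go
    from [s k.+1] along the sequence to the predecessor of [q], jump to [r], and follow the sequence
    from [s i] to [s k], avoiding [q] throughout. *)
Lemma forward_backward k j : 0 < m <= k.+1 -> forward_gap k j ->
  exists2 i, k < i & backward_gap i j.-1.
Proof.
move=> /andP[m0 mk] [q [qk1 nle kj sj nq]].
have {kj}kj : k.+1 < j.
  by case: (eqVneq j k.+1) => [e|]; [move: qk1; rewrite -sj e eqxx|lia].
case: j kj sj nq => // j kj sj nq /=.
have [r [rj rj1 nler Rjr _]] := s_apex j.
(* The visits are sought one period back; [m <= k.+1] keeps the subtractions from truncating. *)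
have [i [ij si nri]] : exists i, [/\ j.+1 - m <= i <= j, s i = r
    & forall l, i < l <= j -> s l != r].
  apply: last_visit; first by lia.
  by rewrite -s_periodic; have -> : j.+1 - m + m = j.+1 by lia.
have [j0 [j0k sj0 nqj0]] : exists j0, [/\ k.+1 - m <= j0 <= k, s j0 = q
    & forall l, j0 < l <= k -> s l != q].
  apply: last_visit; first by lia.
  by rewrite -s_periodic; have -> : k.+1 - m + m = k.+1 by lia.
have rq : r != q by rewrite -sj.
(* Otherwise the segment from [s j0 = q] to [s j] would avoid [r], against [nler]. *)
have j0i : j0 < i.
  case: (ltngtP j0 i) => [//|ij0|e]; last by move: rq; rewrite -si -sj0 e eqxx.
  case: nler; rewrite sj -sj0; apply: le_segment; first by lia.
  by move=> l ?; apply: nri; lia.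
exists i; last first.
  by exists r; split => //; lia.
rewrite ltnNge; apply/negP => ik; case: nle.
have jq : s j != q by apply: nq; lia.
apply: (@le_trans _ _ (s j)) => //.
  by apply: le_segment; [lia|move=> l ?; apply: nq; lia].
apply: (@le_trans _ _ r) => //; first exact: R_le.
by rewrite -si; apply: le_segment => // l ?; apply: nqj0; lia.
Qed.

(** If the apex [q] of the step leaving [r] were first visited after [l], one could go from [s l.+1]
    on to [q], jump to [s i.+1], and continue to [s l], avoiding [r]. *)
Lemma backward_forward i l : 0 < m -> backward_gap i l ->
  exists2 j, j <= l & forward_gap i j.
Proof.
move=> m0 [r [rl nle il si nr]].
have {il}il : i < l.
  by case: (eqVneq i l) => [e|]; [move: rl; rewrite -si e eqxx|lia].
have [q [qi qi1 nleq _ Rqi]] := s_apex i.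
have [j [ij sj nqj]] : exists j, [/\ i.+1 <= j <= i + m, s j = q
    & forall l, i.+1 <= l < j -> s l != q].
  by apply: first_visit; [lia|rewrite s_periodic].
have [i0 [i0l si0 nri0]] : exists i0, [/\ l.+1 <= i0 <= l + m, s i0 = r
    & forall l', l.+1 <= l' < i0 -> s l' != r].
  by apply: first_visit; [lia|rewrite s_periodic].
have qr : q != r by rewrite -si.
exists j; last by exists q; split => //; lia.
rewrite leqNgt; apply/negP => lj.
have ji0 : j < i0.
  case: (ltngtP j i0) => [//|i0j|e]; last by move: qr; rewrite -sj -si0 e eqxx.
  case: nleq; rewrite si -si0; apply: le_segment; first by lia.
  by move=> l' ?; apply: nqj; lia.
case: nle; apply: (@le_trans _ _ q) => //.
  by rewrite -sj; apply: le_segment => // l' ?; apply: nri0; lia.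
apply: (@le_trans _ _ (s i.+1)); [by apply: nr; lia|exact: R_le|].
by apply: le_segment => // l' ?; apply: nr; lia.
Qed.

Lemma no_strict_cycle : 0 < m -> False.
Proof.
move=> m0.
have no_gap n : forall k j, m <= k.+1 -> j - k <= n -> ~ forward_gap k j.
  elim: n => [|n IHn] k j mk jk gap.
    by case: gap => q [_ _ kj _ _]; lia.
  have kj : k < j by case: gap => q [_ _ kj _ _].
  have [|i ki gapi] := forward_backward _ gap; first by rewrite m0.
  have [j' j'j] := backward_forward m0 gapi.
  by apply: IHn; lia.
(* The descent starts at index [m], leaving room to look back one period. *)
have [q [qm qm1 nle _ _]] := s_apex m.
have [j [mj sj nqj]] : exists j, [/\ m.+1 <= j <= m + m, s j = q
    & forall l, m.+1 <= l < j -> s l != q].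
  by apply: first_visit; [lia|rewrite s_periodic].
by apply: (no_gap (j - m) m j) => //; exists q; split => //; lia.
Qed.

End Descent.

(** * No cyclic sequence of strict reachability steps *)

Section StrictReach.
Variables (V : finType) (A : {set V * V}) (turn : V -> V -> V -> Prop).
Hypothesis loopless : forall v, (v, v) \notin A.
Hypothesis turn_cycle : forall c : seq V,
  uniq c -> cycle [rel x y | (x, y) \in A] c ->
  forall v, v \in c -> turn (prev c v) v (next c v).

Notation R := (reach A turn (enum V)).

Lemma strict_reach_acyclic (s : nat -> V) (m : nat) :
    0 < m -> (forall k, s (k + m) = s k) ->
    (forall k, R (s k) (s k.+1)) -> (forall k, ~ R (s k.+1) (s k)) ->
  False.
Proof.
move=> m0 per Rs nRs.
have Ps i j : i < j -> reach A turn [::] (s i) (s j).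
  elim: j => // j IHj ij.
  have Pj : reach A turn [::] (s j) (s j.+1) by apply: reach_sub (Rs j).
  case: (eqVneq i j) => [->//|ne].
  by apply: reach_trans Pj => //; apply: IHj; lia.
(* With period 1 a step and its reverse would coincide; [1 < m] also gives a walk from [s k.+1] on
   to [s (k + m) = s k]. *)
have m1 : 1 < m.
  case: (eqVneq m 1) => [e|]; last by lia.
  by case: (nRs 0); rewrite -[1]/(0 + 1) -e per; have := Rs 0; rewrite -[1]/(0 + 1) -e per.
(* Equality is adjoined because [reach] only sees walks of positive length, while the descent needs
   a reflexive relation. *)
pose le q x y := x = y \/ reach A turn [:: q] x y.
apply: (@no_strict_cycle V R le s m) => //.
- by left.
- move=> q x y z yq [->//|xy] [<-|yz]; right => //.
  by apply: reach_trans xy yz; rewrite inE.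
- by move=> q x y xy; right; apply: reach_sub xy => v _; rewrite mem_enum.
move=> k.
have [|q [qk qk1 nq kq qk']] := reach_apex loopless turn_cycle (Rs k) (nRs k).
  by rewrite -(per k); apply: Ps; lia.
exists q; split => // -[e|]; last exact: nq.
by case: (nRs k); rewrite e; have := Rs k; rewrite e.
Qed.
End StrictReach.

Lemma iter_collision (T : finType) (f : T -> T) (x : T) :
  exists i m, 0 < m /\ iter (i + m) f x = iter i f x.
Proof.
pose g (i : 'I_#|T|.+1) := iter i f x.
have /injectivePn[i [j ij gij]] : ~~ injectiveb g.
  by apply/injectiveP => /leq_card; rewrite card_ord ltnn.
wlog lt_ij : i j ij gij / i < j.
  move=> H; case: (ltngtP i j) => [|ji|/val_inj e]; first exact: H ij gij.
    by apply: (H j i) => //; rewrite eq_sym.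
  by rewrite e eqxx in ij.
exists i, (j - i); split; first by lia.
by rewrite (subnKC (ltnW lt_ij)) -[RHS]/(g i) gij.
Qed.

(** * H-walks as vertex lists and as chains of arcs *)

Section HReach.
Variables (V : finType) (E : {set V * V}) (U : Type) (F : U -> U -> Prop).
Variable col : {e : V * V | e \in E} -> U.

Lemma Hwalk_cons (A : {set V * V}) x y z p :
  Hwalk F col A x [:: y, z & p] <->
  [/\ (x, y) \in A, Hturn F col x y z & Hwalk F col A y (z :: p)].
Proof.
(* The default value of [nth] is the starting vertex, which changes when the first arc is
   removed. *)
have nthE i : i < (size p).+2 -> nth x [:: y, z & p] i = nth y [:: y, z & p] i.
  by move=> ip; apply: set_nth_default.
split=> [[_ arcs turns]|[xy xyz [_ arcs turns]]].
  split; [exact: (arcs 0)|exact: (turns 1)|split => // -[|i] ip //].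
  - exact: (arcs 1).
  - by rewrite -!nthE; [exact: (arcs i.+2)|exact: ip|exact: ltnW].
  - rewrite -!nthE; [exact: (turns i.+2)|exact: ip|exact: ltnW|].
    by apply: ltnW; apply: ltnW.
split => // [[//|i]|[//|[//|i]]] ip.
  have := arcs i ip; rewrite -!nthE //; exact: ltnW.
have := turns i.+1 ip; rewrite -!nthE //; first exact: ltnW.
by apply: ltnW; apply: ltnW.
Qed.

Lemma Hwalk1 (A : {set V * V}) x y : Hwalk F col A x [:: y] <-> (x, y) \in A.
Proof.
split=> [[_ arcs _]|xy]; first exact: (arcs 0).
by split => // [[|]|[|]].
Qed.

Lemma Hreach_reach (A : {set V * V}) x y :
  Hreach F col A x y <-> reach A (Hturn F col) (enum V) x y.
Proof.
split=> [[[|z p] [xp <-]]|[u [v [xu vy uv]]]]; first by case: xp.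
  exists z; elim: p x z xp => [|w p IHp] x z.
    by move/Hwalk1 => xz; exists x; split => //; apply: rt_refl.
  case/Hwalk_cons => xz xzw zp; have [v [zw vy wv]] := IHp _ _ zp.
  exists v; split => //; apply: rt_trans wv.
  by apply: rt_step.
have {}uv := clos_rt_rt1n _ _ _ _ uv.
suff [p xp <-] : exists2 p, Hwalk F col A x (u :: p) & last u p = y.
  by exists (u :: p).
move: xu vy uv; move def_e : (x, u) => e; move def_f : (v, y) => f eA fA ef.
elim: ef eA fA x u def_e v y def_f => {e f} [e eA _ x u def_e v y|].
  rewrite -def_e => -[_ ->]; rewrite -def_e in eA.
  by exists [::] => //; apply/Hwalk1.
move=> e [u' w] f [/= eA gA + tn] _ IH _ fA x u def_e v y def_f.
rewrite -def_e /= in tn * => uu'; subst u'.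
have [p up <-] := IH gA fA _ _ erefl _ _ def_f.
exists (w :: p) => //; apply/Hwalk_cons; split => //; first by rewrite def_e.
by apply: tn; rewrite mem_enum.
Qed.

Lemma Hreach_sub (A B : {set V * V}) x y :
  A \subset B -> Hreach F col A x y -> Hreach F col B x y.
Proof.
move=> /subsetP sAB [p [[p0 arcs turns] xy]]; exists p; split => //.
by split => // i /arcs /sAB.
Qed.
End HReach.

(** * From a cycle of semikernels to a cyclic sequence of vertices *)

Lemma next_invariant (T : finType) (c : seq T) (P : pred T) x y :
    uniq c -> {in c, forall z, P z -> P (next c z)} -> x \in c -> y \in c ->
  P x -> P y.
Proof.
move=> c_uniq Pnext xc yc Px.
have <- : iter (findex (next c) x y) (next c) x = y.
  by rewrite iter_findex // (fconnect_cycle (cycle_next c_uniq)).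
suff : (iter (findex (next c) x y) (next c) x \in c) &&
       P (iter (findex (next c) x y) (next c) x) by case/andP.
elim: (findex _ _ _) => [|n /andP[zc Pz]]; first by rewrite xc.
by rewrite iterS mem_next zc Pnext.
Qed.

Theorem theorem3 (V : finType) (E : {set V * V})
    (loopless : forall v : V, (v, v) \notin E)
    (U : Type) (F : U -> U -> Prop)
    (col : {e : V * V | e \in E} -> U)
    (E1 E2 : {set V * V})
    (E12_cover : E1 :|: E2 = E) (E12_disjoint : [disjoint E1 & E2])
    (E1_cycles : forall c : seq V,
       dicycle (fun x y => (x, y) \in E1) c -> Hcycle F col c) :
  acyclic (Hsemikernel_arc F col E1 E2).
Proof.
have sE1E : E1 \subset E by rewrite -E12_cover subsetUl.
have loopless1 v : (v, v) \notin E1 by apply: contra (loopless v); apply: subsetP.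
have turn_cycle c : uniq c -> cycle [rel x y | (x, y) \in E1] c ->
    forall v, v \in c -> Hturn F col (prev c v) v (next c v).
  move=> c_uniq c_cycle v vc; case: (E1_cycles c) => [|_]; last exact.
  split => //; first by move=> c0; rewrite c0 in vc.
  by move=> x xc; apply: (next_cycle c_cycle).
pose T x y := reach E1 (Hturn F col) (enum V) x y /\
  ~ reach E1 (Hturn F col) (enum V) y x.
case=> c [c0 c_uniq c_arc].
pose leaving v := has (fun S : {set V} => v \in S :\: next c S) c.
(* The existential stands outside the implication so that choice yields a total function [f] to
   iterate. *)
have next_leaving v : exists w, leaving v -> leaving w /\ T v w.
  case: (boolP (leaving v)) => [|_]; last by exists v.
  case/hasP => S Sc vS; have [_ _ _ /(_ v vS)] := c_arc S Sc.
  move=> [w [wS vw nwS]]; exists w => _; split; last first.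
    split; first exact/Hreach_reach.
    move=> /Hreach_reach/(Hreach_sub sE1E); apply: nwS.
    by case/setDP: vS.
  (* If [w] left no semikernel of the cycle, it would persist from [next c S] all the way round to
     [S]. *)
  case/setDP: wS => wS' wS; apply: contraNT wS => /hasPn stay.
  have S'c : next c S \in c by rewrite mem_next.
  apply: (@next_invariant _ c (fun X : {set V} => w \in X) (next c S)) => // X Xc wX.
  by move: (stay X Xc); rewrite inE wX andbT negbK.
have [v0 v0_leaving] : exists v, leaving v.
  have [S Sc] : exists S, S \in c.
    by case: (c) c0 => // S c' _; exists S; rewrite mem_head.
  apply: NNPP => none.
  (* If no vertex leaves, the inclusions run round the cycle and force [S = next c S]. *)
  have sub X : X \in c -> X \subset next c X.
    move=> Xc; apply/subsetP => v vX; apply/negPn/negP => vX'.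
    by apply: none; exists v; apply/hasP; exists X => //; rewrite inE vX' vX.
  have [_ _ neq _] := c_arc S Sc; apply: neq.
  apply/eqP; rewrite eqEsubset sub //=.
  apply: (@next_invariant _ c (fun X : {set V} => next c S \subset X) (next c S)) => //.
    by move=> X Xc sX; apply: subset_trans sX (sub X Xc).
  by rewrite mem_next.
have [f f_leaving] := fin_all_exists next_leaving.
have leaving_iter n : leaving (iter n f v0).
  by elim: n => // n /f_leaving[].
have [i [m [m0 coll]]] := iter_collision f v0.
have T_iter k : T (iter (i + k) f v0) (iter (i + k.+1) f v0).
  by rewrite addnS; case: (f_leaving _ (leaving_iter (i + k))).
apply: (@strict_reach_acyclic _ _ _ loopless1 turn_cycle
          (fun k => iter (i + k) f v0) m m0) => k; try by case: (T_iter k).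
by rewrite addnCA iterD coll -iterD addnC.
Qed.
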